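(* Let $m\in\mathbb{N}$, $q=3^{2m+1}$ and $U={}^2G_2^{syl}(q)$. Let $\mathcal{K}$ be the family of subsets of $U$ consisting of $C_0$ and of $C_1(t_1^* )$, $C_3(t_3^* )$, $C_4(t_4^* )$ for $t_1^*,t_3^*,t_4^*\in\mathbb{F}_q^*$, and let $\mathcal{X}$ be the set of characters consisting of $\Psi_{M(0)}$ and of $\Psi_{M(A_{12}^*e_{12})}$, $\Psi_{M(A_{13}^*e_{13})}$, $\Psi_{M(A_{14}^*e_{14})}$ for $A_{12}^*,A_{13}^*,A_{14}^*\in\mathbb{F}_q^*$. Then $(\mathcal{X},\mathcal{K})$ is a supercharacter theory for $U$, and the value of each supercharacter on each superclass is given by the following table: $$\begin{array}{l|cccc} & C_0 & C_1(t_1^* ) & C_3(t_3^* ) & C_4(t_4^* )\\ \hline \Psi_{M(0)} & 1 & 1 & 1 & 1\\ \Psi_{M(A_{12}^*e_{12})} & 1 & \vartheta(A_{12}^*t_1^* ) & 1 & 1\\ \Psi_{M(A_{13}^*e_{13})} & q & 0 & q\,\vartheta(-A_{13}^*t_3^* ) & q\\ \Psi_{M(A_{14}^*e_{14})} & q^2 & 0 & 0 & q^2\,\vartheta(-A_{14}^*t_4^* ) \end{array}$$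
   Context: Let $m\in\mathbb{N}=\{0,1,2,\dots\}$, $q=3^{2m+1}$, $\theta=3^m$; $\mathbb{F}_q$ is the field with $q$ elements, $\mathbb{F}_q^*=\mathbb{F}_q\setminus\{0\}$, and $e_{ij}=e_{i,j}$ are the $8\times8$ matrix units over $\mathbb{F}_q$. The group $U$. Put $E_1=(e_{1,2}-e_{7,8})+(e_{3,4}-e_{5,6})+(e_{3,5}-e_{4,6})$, $E_2=e_{2,3}-e_{6,7}$, $E_3=-(e_{1,3}-e_{6,8})+(e_{2,4}-e_{5,7})+(e_{2,5}-e_{4,7})$, $E_4=-(e_{1,4}-e_{5,8})-(e_{2,6}-e_{3,7})-(e_{1,5}-e_{4,8})$, $E_5=-(e_{1,6}-e_{3,8})$, $E_6=-(e_{1,7}-e_{2,8})$, and $y_i(t)=I_8+tE_i+\tfrac12t^2E_i^2$ for $t\in\mathbb{F}_q$. For $t_1,t_3,t_4\in\mathbb{F}_q$ set $$Y(t_1,t_3,t_4)=y_2(t_1^{3\theta})\,y_1(t_1)\,y_3(t_3)\,y_4(t_4)\,y_5(t_3^{3\theta}+t_1^{3\theta+3})\,y_6(t_4^{3\theta}+t_1^{6\theta+3}).$$ Then $U={}^2G_2^{syl}(q)=\{Y(t_1,t_3,t_4): t_1,t_3,t_4\in\mathbb{F}_q\}$, a group of order $q^3$ (a Sylow $3$-subgroup of the Ree group ${}^2G_2(q)$). Orbit modules. Let $V=\mathbb{F}_qe_{12}\oplus\mathbb{F}_qe_{13}\oplus\mathbb{F}_qe_{14}$, let $\pi(B)=B_{12}e_{12}+B_{13}e_{13}+B_{14}e_{14}$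 for an $8\times 8$ matrix $B$, $\kappa(A,B)=\mathrm{tr}(A^\top B)$, and fix a nontrivial linear character $\vartheta:\mathbb{F}_q^+\to\mathbb{C}^*$. For $A\in V$ and $u\in U$ put $\chi_A(u)=\vartheta(\kappa(A,\pi(u)))$, $A.u=\pi(Au^{-\top})$, and $[A]=\frac1{|U|}\sum_{u\in U}\overline{\chi_A(u)}\,u\in\mathbb{C}U$. The elements $[A]$ ($A\in V$) form a basis of $\mathbb{C}U$ and $[A]u=\chi_{A.u}(u)[A.u]$ under right multiplication. The $U$-orbit module of $A$ is the right $\mathbb{C}U$-module $\mathbb{C}\mathcal{O}_U([A])=\mathbb{C}\text{-span}\{[A.u]:u\in U\}$. Set $M(B)=\mathbb{C}\mathcal{O}_U([B])$ for $B\in\{0,\ A_{12}^*e_{12},\ A_{13}^*e_{13},\ A_{14}^*e_{14}\}$ (with $A_{1j}^*\in\mathbb{F}_q^*$), and let $\Psi_{M(B)}$ be the complex character of $M(B)$ (the trace of the right action of $u\in U$). Superclasses. For $t\in\mathbb{F}_q^*$ let $\varsigma_t:\mathbb{F}_q^+\to\mathbb{F}_q^+$, $s\mapsto ts^{3\theta}-t^{3\theta}s$, and let ${}^{t}T$ be a transversal of $\mathrm{im}\,\varsigma_t$ in $\mathbb{F}_q^+$. Writing ${}^Ux=\{vxv^{-1}:v\in U\}$, set $C_0=\{I_8\}$, $C_4(t_4^* )={}^UY(0,0,t_4^* )$, $C_3(t_3^* )={}^UY(0,t_3^*,0)$, $C_1(t_1^* )=\bigcup_{t_3\in{}^{t_1^*}T}{}^UY(t_1^*,t_3,0)$.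 Supercharacter theory. For a finite group $G$, a pair $(\mathcal{X},\mathcal{K})$, where $\mathcal{K}$ is a partition of $G$ and $\mathcal{X}$ is a set of nonzero complex characters of $G$, is a supercharacter theory for $G$ if (a) $|\mathcal{X}|=|\mathcal{K}|$; (b) every $\chi\in\mathcal{X}$ is constant on each member of $\mathcal{K}$; (c) the elements of $\mathcal{X}$ are pairwise orthogonal; (d) $\{1\}\in\mathcal{K}$. Elements of $\mathcal{X}$ are supercharacters and elements of $\mathcal{K}$ are superclasses. *)

(* Defs.v *)
From HB Require Import structures.
From Stdlib Require Import ZArith Ring_polynom InitialRing Ring_theory.
From mathcomp Require Import all_boot all_order all_algebra all_fingroup.
From mathcomp Require Import all_field all_character finmap.

Set Implicit Arguments.
Unset Strict Implicit.
Unset Printing Implicit Defensive.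

Import GRing.Theory Num.Theory.
Local Open Scope ring_scope.

Section Matrices.
Variable F : fieldType.

(* Indices are 1-based, as in e_(1,2), ..., e_(7,8). *)
Definition entry (B : 'M[F]_8) (i j : nat) : F := B (inord i.-1) (inord j.-1).
Definition e (i j : nat) : 'M[F]_8 := delta_mx (inord i.-1) (inord j.-1).

Definition E1 := (e 1 2 - e 7 8) + (e 3 4 - e 5 6) + (e 3 5 - e 4 6).
Definition E2 := e 2 3 - e 6 7.
Definition E3 := - (e 1 3 - e 6 8) + (e 2 4 - e 5 7) + (e 2 5 - e 4 7).
Definition E4 := - (e 1 4 - e 5 8) - (e 2 6 - e 3 7) - (e 1 5 - e 4 8).
Definition E5 := - (e 1 6 - e 3 8).
Definition E6 := - (e 1 7 - e 2 8).

Definition root_mx (E : 'M[F]_8) (t : F) : 'M[F]_8 :=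
  1%:M + t *: E + (2%:R^-1 * t ^+ 2) *: (E *m E).
Definition y1 := root_mx E1.
Definition y2 := root_mx E2.
Definition y3 := root_mx E3.
Definition y4 := root_mx E4.
Definition y5 := root_mx E5.
Definition y6 := root_mx E6.

Definition Ymx (m : nat) (t1 t3 t4 : F) : 'M[F]_8 :=
  let theta := (3 ^ m)%N in
  y2 (t1 ^+ (3 * theta)) *m y1 t1 *m y3 t3 *m y4 t4
  *m y5 (t3 ^+ (3 * theta) + t1 ^+ (3 * theta + 3))
  *m y6 (t4 ^+ (3 * theta) + t1 ^+ (6 * theta + 3)).

End Matrices.

(* Polynomial identities between 8 x 8 matrices in characteristic 3 are decided
   by computing with lists of polynomials with coefficients in Z modulo 3. *)
Module CharThree.

Definition eqb3 (x y : Z) : bool := Z.eqb (Z.modulo (Z.sub x y) (Zpos 3)) Z0.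
Definition poly := Pol Z.
Definition padd : poly -> poly -> poly := Padd Z0 Z.add eqb3.
Definition pmul : poly -> poly -> poly := Pmul Z0 (Zpos xH) Z.add Z.mul eqb3.
Definition popp : poly -> poly := Popp Z.opp.
Definition psub x y := padd x (popp y).
Definition pX (p : positive) : poly := mk_X Z0 (Zpos xH) p.
Definition p0 : poly := Pc Z0.
Definition p1 : poly := Pc (Zpos xH).

Definition lmx := seq (seq poly).
Definition lat (A : lmx) i j : poly := nth p0 (nth [::] A i) j.
Definition mk (f : nat -> nat -> poly) : lmx :=
  [seq [seq f i j | j <- iota 0 8] | i <- iota 0 8].
Definition lmul (A B : lmx) := mk (fun i j =>
  foldr (fun k s => padd (pmul (lat A i k) (lat B k j)) s) p0 (iota 0 8)).
Definition ladd (A B : lmx) := mk (fun i j => padd (lat A i j) (lat B i j)).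
Definition lscale x (A : lmx) := mk (fun i j => pmul x (lat A i j)).
Definition lopp (A : lmx) := mk (fun i j => popp (lat A i j)).
Definition lid := mk (fun i j => if i == j then p1 else p0).
Definition le (a b : nat) :=
  mk (fun i j => if (i == a.-1) && (j == b.-1) then p1 else p0).
Definition lroot (E : lmx) t :=
  ladd (ladd lid (lscale t E)) (lscale (popp (pmul t t)) (lmul E E)).
Definition leqb (A B : lmx) :=
  all (fun i => all (fun j => Peq eqb3 (lat A i j) (lat B i j)) (iota 0 8))
      (iota 0 8).

Definition leqb_lower (A : lmx) :=
  all (fun i => all (fun j => Peq eqb3 (lat A i j) (lat lid i j)) (iota 0 i.+1))
      (iota 0 8).

Section Lists.
Local Notation "A + B" := (ladd A B).
Local Notation "A - B" := (ladd A (lopp B)).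
Local Notation "- A" := (lopp A).

Definition lE1 := (le 1 2 - le 7 8) + (le 3 4 - le 5 6) + (le 3 5 - le 4 6).
Definition lE2 := le 2 3 - le 6 7.
Definition lE3 := - (le 1 3 - le 6 8) + (le 2 4 - le 5 7) + (le 2 5 - le 4 7).
Definition lE4 := - (le 1 4 - le 5 8) - (le 2 6 - le 3 7) - (le 1 5 - le 4 8).
Definition lE5 := - (le 1 6 - le 3 8).
Definition lE6 := - (le 1 7 - le 2 8).

End Lists.

Definition cube x := pmul x (pmul x x).

(* a', b', c' stand for the images of a, b, c under t |-> t ^+ (3 * 3 ^ m). *)
Definition lY a a' b b' c c' :=
  lmul (lmul (lmul (lmul (lmul (lroot lE2 a') (lroot lE1 a)) (lroot lE3 b))
    (lroot lE4 c)) (lroot lE5 (padd b' (pmul a' (cube a)))))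
    (lroot lE6 (padd c' (pmul (pmul a' a') (cube a)))).

Section Product.
Local Notation a := (pX 1). Local Notation a' := (pX 2).
Local Notation b := (pX 3). Local Notation b' := (pX 4).
Local Notation c := (pX 5). Local Notation c' := (pX 6).
Local Notation d := (pX 7). Local Notation d' := (pX 8).
Local Notation e := (pX 9). Local Notation e' := (pX 10).
Local Notation f := (pX 11). Local Notation f' := (pX 12).
Local Infix "+" := padd. Local Infix "-" := psub. Local Infix "*" := pmul.

(* The part of lY on and below the diagonal is that of the identity. *)
Lemma lY_lower : leqb_lower (lY a a' b b' c c').
Proof. by vm_compute. Qed.

Lemma lY_mul :
  leqb (lmul (lY a a' b b' c c') (lY d d' e e' f f'))
  (lY (a + d) (a' + d') (b + e - a * d') (b' + e' - a' * cube d)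
      (c + f - b * d - a * a * d' + a * (d * d'))
      (c' + f' - b' * d' - a' * a' * cube d + a' * (d' * cube d))).
Proof. by vm_compute. Qed.

End Product.

Section Eval.
Variables (F : fieldType) (char3 : 3%:R = 0 :> F) (l : seq F).

Definition phi : Z -> F := gen_phiZ 0 1 +%R *%R -%R.
Definition ev : poly -> F := Pphi 0 +%R *%R phi l.

Lemma F_ring : ring_theory (0 : F) 1 +%R *%R (fun x y => x - y) -%R eq.
Proof.
split=> *; rewrite ?(add0r, mul1r, addrA, mulrA, mulrDl, subrr) //.
- exact: addrC.
- exact: mulrC.
Qed.

Let ext : ring_eq_ext (+%R : F -> F -> F) *%R -%R eq := Eq_ext _ _ _.
Let art := Rth_ARth (Eqsth F) ext F_ring.

Lemma phi_morph : ring_morph (0 : F) 1 +%R *%R (fun x y => x - y) -%R eq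
  Z0 (Zpos xH) Z.add Z.mul Z.sub Z.opp eqb3 phi.
Proof.
have [m0 m1 mD mB mM mN _] := gen_phiZ_morph (Eqsth F) ext F_ring.
split=> // x y /Z.eqb_eq /Z.mod_divide [//|k Dxy].
apply/eqP; rewrite -subr_eq0 -[_ - _]mB Dxy mM; apply/eqP.
by rewrite [X in _ * X = _](_ : _ = 3%:R) ?char3 ?mulr0 //= mulrDr !mulr1 -natrD.
Qed.

Definition evmx (A : lmx) : 'M[F]_8 := \matrix_(i, j) ev (lat A i j).

Lemma evD x y : ev (padd x y) = ev x + ev y.
Proof. exact: (Padd_ok (Eqsth F) ext art phi_morph). Qed.
Lemma evM x y : ev (pmul x y) = ev x * ev y.
Proof. exact: (Pmul_ok (Eqsth F) ext art phi_morph). Qed.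
Lemma evN x : ev (popp x) = - ev x.
Proof. exact: (Popp_ok (Eqsth F) ext art phi_morph). Qed.
Lemma evX p : ev (pX p) = BinList.nth 0 p l.
Proof. exact/esym/(mkX_ok (Eqsth F) ext art phi_morph). Qed.
Lemma ev0 : ev p0 = 0. Proof. by []. Qed.
Lemma ev1 : ev p1 = 1. Proof. by []. Qed.

Lemma lat_mk f (i j : 'I_8) : lat (mk f) i j = f i j.
Proof.
by rewrite /lat (nth_map 0%N) ?size_iota // (nth_map 0%N) ?size_iota // !nth_iota.
Qed.

Lemma evmx_mul A B : evmx (lmul A B) = evmx A *m evmx B.
Proof.
apply/matrixP=> i j; rewrite !mxE lat_mk.
rewrite [RHS](eq_bigr (fun k : 'I_8 => ev (lat A i k) * ev (lat B k j))) => [|k _]; last by rewrite !mxE.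
rewrite -(big_mkord xpredT (fun k => ev (lat A i k) * ev (lat B k j))).
rewrite unlock /index_iota subn0 /reducebig; elim: (iota 0 8) => //= k r IH.
by rewrite evD evM IH.
Qed.

Lemma evmxD A B : evmx (ladd A B) = evmx A + evmx B.
Proof. by apply/matrixP=> i j; rewrite !mxE lat_mk evD. Qed.

Lemma evmxN A : evmx (lopp A) = - evmx A.
Proof. by apply/matrixP=> i j; rewrite !mxE lat_mk evN. Qed.

Lemma evmxZ x A : evmx (lscale x A) = ev x *: evmx A.
Proof. by apply/matrixP=> i j; rewrite !mxE lat_mk evM. Qed.

Lemma evmx_id : evmx lid = 1%:M.
Proof.
by apply/matrixP=> i j; rewrite !mxE lat_mk -(inj_eq val_inj) /=; case: eqP.
Qed.

Lemma evmx_e a b : (a <= 8)%N -> (b <= 8)%N -> evmx (le a b) = e F a b.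
Proof.
move=> a8 b8; apply/matrixP=> i j; rewrite !mxE lat_mk -!(inj_eq val_inj) /=.
have lt8 c : (c <= 8)%N -> (c.-1 < 8)%N by case: c.
by rewrite !inordK ?lt8 //; case: (_ && _).
Qed.

Definition evE := (evmxD, evmxN, evmx_e).

Lemma evmx_root A x : evmx (lroot A x) = root_mx (evmx A) (ev x).
Proof.
rewrite /lroot /root_mx !evmxD !evmxZ evmx_id evmx_mul evN evM.
suff -> : (2%:R^-1 : F) = -1 by rewrite mulN1r expr2.
have /eqP: (2%:R + 1 : F) = 0 by rewrite natr1 char3.
rewrite addr_eq0 => /eqP ->; exact: invrN1.
Qed.

Lemma leqbP A B : leqb A B -> evmx A = evmx B.
Proof.
have in8 (k : 'I_8) : val k \in iota 0 8 by rewrite mem_iota /=.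
move=> /allP eqAB; apply/matrixP=> i j; rewrite !mxE.
have /allP eqABi := eqAB _ (in8 i).
exact: (Peq_ok (Eqsth F) ext phi_morph _ _ (eqABi _ (in8 j)) l).
Qed.

Lemma leqb_lowerP A : leqb_lower A -> forall i j : 'I_8, (j <= i)%N ->
  evmx A i j = (1%:M : 'M_8) i j.
Proof.
move=> /allP eqA i j le_ji; rewrite -evmx_id !mxE.
have i8 : val i \in iota 0 8 by rewrite mem_iota /=.
have j_i : val j \in iota 0 i.+1 by rewrite mem_iota.
have /allP eqAi := eqA _ i8.
exact: (Peq_ok (Eqsth F) ext phi_morph _ _ (eqAi _ j_i) l).
Qed.

Lemma evmx_Y a a' b b' c c' :
  evmx (lY a a' b b' c c') =
    y2 (ev a') *m y1 (ev a) *m y3 (ev b) *m y4 (ev c)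
    *m y5 (ev b' + ev a' * ev a ^+ 3) *m y6 (ev c' + ev a' ^+ 2 * ev a ^+ 3).
Proof. by rewrite !evmx_mul !evmx_root !evE // !evD !evM !exprS !expr0 !mulr1. Qed.
End Eval.

End CharThree.

Section Group.
Variables (m : nat) (F : finFieldType).
Hypothesis cardF : #|F| = (3 ^ (2 * m + 1))%N.

Let char3 : 3%:R = 0 :> F.
Proof. by have := card_finPcharP cardF isT; rewrite inE => /andP[_ /eqP]. Qed.

Definition frob (x : F) : F := x ^+ (3 * 3 ^ m).

Lemma Ymx_ev l a a' b b' c c' :
    CharThree.ev l a' = frob (CharThree.ev l a) ->
    CharThree.ev l b' = frob (CharThree.ev l b) ->
    CharThree.ev l c' = frob (CharThree.ev l c) ->
  Ymx m (CharThree.ev l a) (CharThree.ev l b) (CharThree.ev l c) =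
  CharThree.evmx l (CharThree.lY a a' b b' c c').
Proof.
move=> Ea Eb Ec; rewrite CharThree.evmx_Y ?char3 // Ea Eb Ec /Ymx /frob.
set n := (3 ^ m)%N.
rewrite (_ : (6 * n = 3 * n * 2)%N); last exact: mulnAC 3 2 n.
by rewrite 2!(exprD _ _ 3) (exprM _ (3 * n) 2).
Qed.

Lemma Ymx_mul t1 t3 t4 s1 s3 s4 :
  Ymx m t1 t3 t4 *m Ymx m s1 s3 s4 =
  Ymx m (t1 + s1) (t3 + s3 - t1 * frob s1)
    (t4 + s4 - t3 * s1 - t1 * t1 * frob s1 + t1 * (s1 * frob s1)).
Proof.
have sM : {morph frob : x y / x * y} by move=> x y; rewrite /frob exprMn.
have sD : {morph frob : x y / x + y}.
  move=> x y; rewrite /frob -expnS; apply: (exprDn_pchar x y).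
  by rewrite pnatX pnatE // (card_finPcharP cardF).
have sN : {morph frob : x / - x}.
  by move=> x; rewrite /frob -expnS exprNn -signr_odd oddX orbT mulN1r.
have ss x : frob (frob x) = x ^+ 3.
  rewrite /frob -exprM mulnACA -expnD addnn -mul2n.
  have -> : (3 * 3 * 3 ^ (2 * m) = 3 * #|F|)%N by rewrite cardF addn1 expnS mulnA.
  by rewrite mulnC exprM expf_card.
pose l := [:: t1; frob t1; t3; frob t3; t4; frob t4;
              s1; frob s1; s3; frob s3; s4; frob s4].
have := @CharThree.leqbP F char3 l _ _ CharThree.lY_mul.
have evE := (CharThree.evD char3 l, CharThree.evN char3 l,
  CharThree.evM char3 l, CharThree.evX char3 l).
rewrite (CharThree.evmx_mul char3) -!Ymx_ev ?/CharThree.psub ?/CharThree.cube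
  ?evE //=.
all: by rewrite ?(sD, sN, sM, ss) ?exprS ?expr0 ?mulr1.
Qed.

Lemma Ymx0 : Ymx m 0 0 0 = 1%:M :> 'M[F]_8.
Proof.
have E0 (E : 'M[F]_8) : root_mx E 0 = 1%:M.
  by rewrite /root_mx expr0n mulr0 !scale0r !addr0.
have n0 : (0 : F) ^+ (3 * 3 ^ m) = 0 by rewrite -expnS expr0n expn_eq0.
by rewrite /Ymx !(exprD _ _ 3) !n0 expr0n !mulr0 !addr0 /y1 /y2 /y3 /y4 /y5 /y6
  !E0 !mulmx1.
Qed.

Lemma Ymx_unitriangular (t1 t3 t4 : F) (i j : 'I_8) :
  (j <= i)%N -> Ymx m t1 t3 t4 i j = (i == j)%:R.
Proof.
pose l := [:: t1; frob t1; t3; frob t3; t4; frob t4].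
have evX := CharThree.evX char3 l.
have := @Ymx_ev l (CharThree.pX 1) (CharThree.pX 2) (CharThree.pX 3)
  (CharThree.pX 4) (CharThree.pX 5) (CharThree.pX 6).
rewrite !evX /= => -> // le_ji.
have := @CharThree.leqb_lowerP F char3 l _ CharThree.lY_lower i j le_ji.
by rewrite !mxE.
Qed.

Lemma Ymx_unit (t1 t3 t4 : F) : Ymx m t1 t3 t4 \is a GRing.unit.
Proof.
rewrite -[_ \is a _]/(_ \in unitmx) -unitmx_tr unitmxE det_trig.
  rewrite big1 ?unitr1 // => i _.
  by rewrite mxE Ymx_unitriangular ?eqxx.
apply/is_trig_mxP => i j ltij; rewrite mxE Ymx_unitriangular 1?ltnW //.
by rewrite -(inj_eq val_inj) /= gtn_eqF.
Qed.

Definition Y (t1 t3 t4 : F) : {'GL_8[F]} := FinRing.Unit (Ymx_unit t1 t3 t4).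

Definition Usyl_set : {set {'GL_8[F]}} :=
  [set Y t.1.1 t.1.2 t.2 | t : F * F * F].

Lemma Usyl_group_set : group_set Usyl_set.
Proof.
apply/group_setP; split.
  by apply/imsetP; exists (0, 0, 0) => //; apply/val_inj; rewrite /= Ymx0.
move=> _ _ /imsetP[[[t1 t3] t4] _ ->] /imsetP[[[s1 s3] s4] _ ->] /=.
apply/imsetP; exists (t1 + s1, t3 + s3 - t1 * frob s1,
  t4 + s4 - t3 * s1 - t1 * t1 * frob s1 + t1 * (s1 * frob s1)) => //.
by apply/val_inj; rewrite [LHS]Ymx_mul.
Qed.

Definition Usyl : {group {'GL_8[F]}} := Group Usyl_group_set.

End Group.

Section OrbitModules.
Variable F : finFieldType.
Local Notation gT := {'GL_8[F]}.

Definition V : {vspace 'M[F]_8} := (<[e F 1 2]> + <[e F 1 3]> + <[e F 1 4]>)%VS.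

Lemma e12_in_V : e F 1 2 \in V.
Proof. exact: (subvP (subv_trans (addvSl _ _) (addvSl _ _))) (memv_line _). Qed.
Lemma e13_in_V : e F 1 3 \in V.
Proof. exact: (subvP (subv_trans (addvSr _ _) (addvSl _ _))) (memv_line _). Qed.
Lemma e14_in_V : e F 1 4 \in V.
Proof. exact: (subvP (addvSr _ _)) (memv_line _). Qed.

Definition e12 : subvs_of V := Subvs e12_in_V.
Definition e13 : subvs_of V := Subvs e13_in_V.
Definition e14 : subvs_of V := Subvs e14_in_V.

Definition projV (B : 'M[F]_8) : 'M[F]_8 :=
  entry B 1 2 *: e F 1 2 + entry B 1 3 *: e F 1 3 + entry B 1 4 *: e F 1 4.

Definition kappa (A B : 'M[F]_8) : F := \tr (A^T *m B).

Definition actV (A : 'M[F]_8) (u : gT) : 'M[F]_8 := projV (A *m (GLval u^-1%g)^T).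

Definition chiV (vartheta : 'CF([set: F])) (A : 'M[F]_8) (u : gT) : algC :=
  vartheta (kappa A (projV (GLval u))).

(* The group algebra of U is 'rV[algC]_#|U|, with basis indexed by gring_index;
   U acts on the right through the regular representation. *)
Definition bracket (vartheta : 'CF([set: F])) (U : {group gT}) (A : 'M[F]_8) :
    'rV[algC]_#|U| :=
  (#|U|%:R)^-1 *:
    \sum_(u in U) (chiV vartheta A u)^* *: delta_mx 0 (gring_index U u).

Definition orbit_module (vartheta : 'CF([set: F])) (U : {group gT})
    (A : 'M[F]_8) : 'M[algC]_#|U| :=
  (\sum_(u in U) <<bracket vartheta U (actV A u)>>)%MS.

Let inV (i j : 'I_8) := (i == 0 :> nat) && (0 < j < 4)%N.

Lemma projVE B i j : projV B i j = if inV i j then B i j else 0.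
Proof.
rewrite /projV /entry /e !mxE -!(inj_eq val_inj) /= !inordK //=.
rewrite /inV; have key k : B (inord 0) (inord k) * (((i : nat) == 0%N) && ((j : nat) == k))%:R =
    if ((i : nat) == 0%N) && ((j : nat) == k) then B i j else 0.
  case: ifP => [/andP[/eqP i0 /eqP jk]|_]; last by rewrite mulr0.
  rewrite mulr1; congr (B _ _); apply/val_inj; rewrite /= inordK //.
  by rewrite -jk.
rewrite !key; case: (i == 0 :> nat) => /=; last by rewrite !addr0.
move: (B i j) => b; case: (j : nat) => [|[|[|[|n]]]] /=;
  by rewrite ?(addr0, add0r).
Qed.

Lemma V_supp (B : 'M[F]_8) : B \in V -> projV B = B.
Proof.
have proj_e c k : (0 < k < 4)%N -> projV (c *: e F 1 k.+1) = c *: e F 1 k.+1.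
  move=> k13; apply/matrixP=> a b; rewrite projVE !mxE /=.
  case: ifP => // notV; case: andP => [[/eqP ea /eqP eb]|]; last by rewrite mulr0.
  have k8 : (k < 8)%N by case/andP: k13 => _ /leq_trans->.
  by move: notV; rewrite /inV ea eb !inordK // k13.
have projD A C : projV (A + C) = projV A + projV C.
  by apply/matrixP=> a b; rewrite [RHS]mxE !projVE mxE; case: ifP; rewrite ?addr0.
rewrite /V => /memv_addP[_ /memv_addP[_ /vlineP[a ->] [_ /vlineP[b ->] ->]]].
by case=> _ /vlineP[c ->] ->; rewrite !projD (proj_e a 1%N) ?(proj_e b 2%N) ?(proj_e c 3%N).
Qed.

Lemma projVK B : projV (projV B) = projV B.
Proof. by apply/matrixP=> i j; rewrite !projVE; case: (inV i j). Qed.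

Definition unitriangular (u : gT) :=
  forall i j : 'I_8, (j <= i)%N -> GLval u i j = (i == j)%:R.

Section Unitriangular.
Variable U : {group gT}.
Hypothesis Uuni : {in U, forall u, unitriangular u}.

Lemma uni u (i j : 'I_8) : u \in U -> (j <= i)%N -> GLval u i j = (i == j)%:R.
Proof. by move=> Uu; apply: Uuni. Qed.

Lemma actV_mul A u v : projV A = A -> u \in U -> v \in U ->
  actV A (u * v)%g = actV (actV A u) v.
Proof.
move=> VA Uu Uv; rewrite /actV invMg GL_ME.
suff proj_mul w z : w \in U -> z \in U ->
    projV (A *m (GLval z *m GLval w)^T) =
    projV (projV (A *m (GLval w)^T) *m (GLval z)^T).
  exact: (proj_mul (u^-1)%g (v^-1)%g (groupVr Uu) (groupVr Uv)).
move=> {u v Uu Uv} Uw Uz.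
apply/matrixP=> i j; rewrite !projVE.
case: ifP => // Vij; rewrite trmx_mul mulmxA !mxE.
apply: eq_bigr => k _; rewrite projVE.
case: ifPn => // nVik; move: Vij nVik; rewrite /inV => /andP[-> /=].
rewrite !mxE => /andP[j0 j4]; rewrite negb_and -leqNgt leqn0 -leqNgt.
case/orP=> [k0|k4].
  rewrite (@uni z j k) ?(eqP k0) // -(inj_eq val_inj) /=.
  by rewrite (eqP k0) gtn_eqF // !mulr0.
rewrite big1 ?mul0r // => a _; rewrite -{1}VA projVE mxE.
case: ifP => [/andP[_ /andP[_ a4]]|_]; last by rewrite mul0r.
have ltak : (a < k)%N by apply: leq_trans a4 k4.
by rewrite uni // 1?ltnW // -(inj_eq val_inj) /= gtn_eqF ?mulr0.
Qed.

Lemma kappa_projV A B : kappa A (projV B) = \sum_i \sum_j projV A i j * B i j.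
Proof.
rewrite /kappa /mxtrace exchange_big; apply: eq_bigr => j _; rewrite mxE.
apply: eq_bigr => i _; rewrite mxE !projVE.
by case: ifP; rewrite ?(mulr0, mul0r).
Qed.

Lemma kappa_mul A x u : projV A = A -> x \in U -> u \in U ->
  kappa A (projV (GLval (x * u)%g)) =
  kappa (actV A u^-1) (projV (GLval x)) + kappa A (projV (GLval u)).
Proof.
move=> VA Ux Uu; rewrite GL_ME !kappa_projV VA /actV projVK invgK.
have := fun i j => @uni x i j Ux; have := fun i j => @uni u i j Uu.
move: (GLval x) (GLval u) => X W uniW uniX.
rewrite -big_split; apply: eq_bigr => i _; under eq_bigr do rewrite mxE big_distrr /=.
rewrite exchange_big /= [X in _ = _ + X](_ : _ =
    \sum_k if k == i then \sum_j A i j * W k j else 0); last first.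
  by rewrite -big_mkcond big_pred1_eq.
rewrite -big_split; apply: eq_bigr => k _ /=.
have -> : \sum_j A i j * (X i k * W k j) = X i k * \sum_j A i j * W k j.
  by rewrite big_distrr; apply: eq_bigr => j _; rewrite mulrCA.
rewrite projVE; case: (eqVneq (i : nat) 0%N) => [i0|i_n0]; last first.
  have A0 j : A i j = 0 by rewrite -VA projVE /inV (negPf i_n0).
  rewrite big1 => [|j _]; last by rewrite A0 mul0r.
  by rewrite /inV (negPf i_n0) mul0r add0r mulr0 if_same.
rewrite /inV i0 /=; case: (eqVneq k i) => [->|k_neq_i].
  by rewrite i0 mul0r add0r uniX // eqxx mul1r.
have k_gt0 : (0 < k)%N.
  rewrite lt0n; apply: contraNneq k_neq_i => k0.
  exact/eqP/val_inj/(etrans k0)/esym.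
rewrite k_gt0 addr0 mxE; case: ltnP => [k4|k4] /=.
  by rewrite mulrC; congr (_ * _); apply: eq_bigr => j _; rewrite mxE.
rewrite mul0r big1 ?mulr0 // => j _.
rewrite -{1}VA projVE; case: ifP => [/andP[_ /andP[_ j4]]|_]; last by rewrite mul0r.
have ltjk : (j < k)%N by apply: leq_trans j4 k4.
by rewrite uniW 1?ltnW // -(inj_eq val_inj) /= gtn_eqF ?mulr0.
Qed.

Variable vartheta : 'CF([set: F]).
Hypothesis lin_vartheta : vartheta \is a linear_char.

Lemma bracket_mul A u : projV A = A -> u \in U ->
  bracket vartheta U A *m regular_repr algC U u =
  (chiV vartheta A u^-1)^* *: bracket vartheta U (actV A u).
Proof.
move=> VA Uu; rewrite /bracket -scalemxAl scalerA mulrC -scalerA; congr (_ *: _).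
rewrite mulmx_suml scaler_sumr [RHS](reindex_inj (mulIg u)) /=.
apply: eq_big => x; first by rewrite groupMr.
move=> Ux; rewrite -scalemxAl -rowE rowK gring_indexK // scalerA -rmorphM.
congr (_ ^* *: _); rewrite /chiV.
have [Uxu Uu'] := (groupM Ux Uu, groupVr Uu).
rewrite -{1}(mulgK u x) (kappa_mul VA Uxu Uu') invgK addrC.
by rewrite -lin_charM ?inE.
Qed.

Lemma orbit_moduleP A : projV A = A ->
  mxmodule (regular_repr algC U) (orbit_module vartheta U A).
Proof.
move=> VA; apply/mxmoduleP=> v Uv; rewrite sumsmxMr.
apply/sumsmx_subP=> u Uu; rewrite (eqmxMr _ (genmxE _)).
rewrite bracket_mul ?projVK // -actV_mul //; apply: scalemx_sub.
by apply: (sumsmx_sup (u * v)%g); rewrite ?groupM ?genmxE.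
Qed.

End Unitriangular.
End OrbitModules.

Section ReeSylow.
Variables (m : nat) (F : finFieldType).
Hypothesis cardF : #|F| = (3 ^ (2 * m + 1))%N.
Let U := Usyl cardF.

Lemma Usyl_unitriangular : {in U, forall u, unitriangular u}.
Proof.
move=> _ /imsetP[[[t1 t3] t4] _ ->] i j; exact: (Ymx_unitriangular cardF).
Qed.

Section OrbitCharacter.
Variable vartheta : 'CF([set: F]).
Hypothesis lin_vartheta : vartheta \is a linear_char.

Definition orbit_char (B : subvs_of (V F)) : 'CF(U) :=
  cfRepr (submod_repr
    (orbit_moduleP Usyl_unitriangular lin_vartheta (V_supp (subvsP B)))).

End OrbitCharacter.

Definition varsigma (t s : F) : F :=
  t * s ^+ (3 * 3 ^ m) - t ^+ (3 * 3 ^ m) * s.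

(* The cosets of the image of varsigma are taken in the additive group of F. *)
Definition varsigma_transversal (t : F) (T : {set F}) : bool :=
  is_transversal T (rcosets (varsigma t @: [set: F]) [set: F]) [set: F].

(* x ^: U is the set of all v^-1 x v with v in the group U, that is, of all
   v x v^-1. *)
Definition C0 : {set {'GL_8[F]}} := [set 1%g].
Definition C1 (T : F -> {set F}) (t1 : F) : {set {'GL_8[F]}} :=
  \bigcup_(t3 in T t1) (Y cardF t1 t3 0 ^: U)%g.
Definition C3 (t3 : F) : {set {'GL_8[F]}} := (Y cardF 0 t3 0 ^: U)%g.
Definition C4 (t4 : F) : {set {'GL_8[F]}} := (Y cardF 0 0 t4 ^: U)%g.

End ReeSylow.

Definition supercharacter_theory (gT : finGroupType) (G : {group gT})
    (X : {fset 'CF(G)}) (K : {set {set gT}}) : Prop :=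
  [/\ partition K G /\ (forall chi, chi \in X -> chi \is a character /\ chi != 0),
      #|` X| = #|K|,
      (forall chi, chi \in X ->
         {in K, forall B : {set gT}, {in B &, forall x y, chi x = chi y}}),
      (forall chi psi, chi \in X -> psi \in X -> chi != psi -> '[chi, psi] = 0)
    & [set 1%g] \in K].

(* Main.v *)
(* The element [B] is a multiple of the sum of conj(chi_B(u)) u, and the
   chi_B, B in V, are pairwise orthogonal functions on U: the entries 12, 13,
   14 of Y(t1, t3, t4) are t1, - t3, t1 t3 - t4, so they run over F^3. Hence
   the [B] with B in the orbit of A are a basis of the orbit module, on which
   U acts monomially, and its character at u is the sum of the chi_B(u) over
   the B in the orbit that u fixes. The orbits of a e12, a e13, a e14 have 1,
   q, q^2 elements, namely all the vectors of V with the same last nonzero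
   entry, which gives the table. On the group side, C1(t1), C3(t3), C4(t4)
   consist of all the Y with first nonzero coordinate the given one; the
   transversal is what completes a union of classes to all the Y with a given
   t1. Both the supercharacters and the superclasses are thus indexed by 1 +
   3 (q - 1) elements, and orthogonality follows by summing the table over
   (t1, t3, t4) with the coordinate of a nontrivial character innermost. *)

Require Import Defs.
From mathcomp Require Import all_boot all_order all_algebra all_fingroup.
From mathcomp Require Import all_field all_character finmap.
From mathcomp Require Import ring.

Import GRing.Theory Num.Theory.
Local Open Scope ring_scope.

Set Implicit Arguments.
Unset Strict Implicit.
Unset Printing Implicit Defensive.

(** The submodule comes with a basis [X] of the library's choosing. If [C] and [D] are the
    transition matrices between [X] and the given basis [W], then [R] acts in the basis [X] by
    [C *m P *m D] with [D *m C = 1%:M], and cyclicity of the trace removes the transition. *)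
Lemma mxtrace_submod (K : fieldType) (n N : nat) (M R : 'M[K]_N)
    (W : 'M[K]_(n, N)) (P : 'M[K]_n) :
  row_free W -> (W :=: M)%MS -> W *m R = P *m W ->
  \tr (in_submod M (val_submod (1%:M : 'M_(\rank M)) *m R)) = \tr P.
Proof.
move=> freeW eqWM WR.
pose X := val_submod (1%:M : 'M_(\rank M)).
have /submxP[C XC] : (X <= W)%MS by rewrite eqWM val_submodP.
have [D DX] : exists D, W = D *m X.
  by exists (in_submod M W); rewrite -val_submodE in_submodK ?eqWM.
have DC : D *m C = 1%:M.
  by apply: (row_free_inj freeW); rewrite -mulmxA -XC -DX mul1mx.
have -> : X *m R = val_submod (C *m P *m D).
  by rewrite [RHS]val_submodE -/X XC -mulmxA WR [in LHS]DX XC !mulmxA.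
by rewrite val_submodK mxtrace_mulC mulmxA DC mul1mx.
Qed.

(** * The twist [frob] and coordinates on the group *)

Section FrobeniusTwist.
Variables (m : nat) (F : finFieldType).
Hypothesis cardF : #|F| = (3 ^ (2 * m + 1))%N.

Lemma char3 : 3%:R = 0 :> F.
Proof. by have := card_finPcharP cardF isT; rewrite inE => /andP[_ /eqP]. Qed.

Lemma frobD : {morph @frob m F : x y / x + y}.
Proof.
move=> x y; rewrite /frob -expnS; apply: (exprDn_pchar x y).
by rewrite pnatX pnatE // (card_finPcharP cardF).
Qed.

Lemma frob0 : frob m (0 : F) = 0.
Proof. by rewrite /frob -expnS expr0n expn_eq0. Qed.

Lemma frobN : {morph @frob m F : x / - x}.
Proof. by move=> x; apply/eqP; rewrite -addr_eq0 -frobD addNr frob0. Qed.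

Lemma frob_eq0 (x : F) : (frob m x == 0) = (x == 0).
Proof. by rewrite /frob -expnS expf_eq0 expn_gt0. Qed.

Lemma frob_inj : injective (@frob m F).
Proof.
move=> x y eq_xy; apply/eqP; rewrite -subr_eq0 -frob_eq0 frobD frobN eq_xy.
by rewrite subrr.
Qed.

Section Entries.
Variables t1 t3 t4 : F.
Import CharThree.

(* [AC] delimits Rocq's [positive_scope] here. *)
Lemma entry_ev (p : poly) (i j : nat) :
    let l := [:: t1; frob m t1; t3; frob m t3; t4; frob m t4] in
    (0 < i <= 8)%N -> (0 < j <= 8)%N ->
    Ring_polynom.Peq eqb3
      (lat (lY (pX 1%AC) (pX 2%AC)
         (pX 3%AC) (pX 4%AC) (pX 5%AC) (pX 6%AC))
         i.-1 j.-1) p ->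
  entry (Ymx m t1 t3 t4) i j = ev l p.
Proof.
move=> l i8 j8 eqp; have evX := evX char3 l.
have := @Ymx_ev m F cardF l (pX 1%AC) (pX 2%AC)
  (pX 3%AC) (pX 4%AC) (pX 5%AC) (pX 6%AC).
rewrite !evX /= => -> //; rewrite /entry mxE !inordK; last 2 first.
- by case: j j8 {eqp}.
- by case: i i8 {eqp}.
(* Soundness of polynomial comparison modulo 3 transfers the symbolic entry to the field; each
   coordinate and its image under [frob] are independent variables there. *)
exact: (Ring_polynom.Peq_ok (Ring_theory.Eqsth F) (Ring_theory.Eq_ext _ _ _)
  (phi_morph char3) _ _ eqp l).
Qed.

Lemma entry_diag (i : nat) : entry (Ymx m t1 t3 t4) i i = 1.
Proof. by rewrite /entry (Ymx_unitriangular cardF) ?eqxx. Qed.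

Lemma entry_lower (i j : nat) : (0 < j < i)%N -> (i <= 8)%N ->
  entry (Ymx m t1 t3 t4) i j = 0.
Proof.
case: i j => [|i] [|j] //=; rewrite ltnS => ji i8; have j8 := ltn_trans ji i8.
rewrite /entry (Ymx_unitriangular cardF) /=.
  by rewrite -(inj_eq val_inj) /= !inordK // gtn_eqF.
by rewrite !inordK // ltnW //.
Qed.

Lemma entry12 : entry (Ymx m t1 t3 t4) 1 2 = t1.
Proof. by rewrite (@entry_ev (pX 1%AC)) // (evX char3). Qed.

Lemma entry13 : entry (Ymx m t1 t3 t4) 1 3 = - t3.
Proof. by rewrite (@entry_ev (popp (pX 3%AC))) // (evN char3) (evX char3). Qed.

Lemma entry14 : entry (Ymx m t1 t3 t4) 1 4 = t1 * t3 - t4.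
Proof.
rewrite (@entry_ev (psub (pmul (pX 1%AC) (pX 3%AC)) (pX 5%AC))) //.
by rewrite (evD char3) (evN char3) (evM char3) !(evX char3).
Qed.

Lemma entry23 : entry (Ymx m t1 t3 t4) 2 3 = frob m t1.
Proof. by rewrite (@entry_ev (pX 2%AC)) // (evX char3). Qed.

Lemma entry24 : entry (Ymx m t1 t3 t4) 2 4 = frob m t1 * t1 + t3.
Proof.
rewrite (@entry_ev (padd (pmul (pX 2%AC) (pX 1%AC)) (pX 3%AC))) //.
by rewrite (evD char3) (evM char3) !(evX char3).
Qed.

Lemma entry34 : entry (Ymx m t1 t3 t4) 3 4 = t1.
Proof. by rewrite (@entry_ev (pX 1%AC)) // (evX char3). Qed.

End Entries.

Lemma Y_inj : injective (fun t : F * F * F => Y cardF t.1.1 t.1.2 t.2).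
Proof.
move=> [[t1 t3] t4] [[s1 s3] s4] /(congr1 val) /= eqY.
have := congr1 (fun A => entry A 1 2) eqY; rewrite !entry12 => Et1.
have := congr1 (fun A => entry A 1 3) eqY; rewrite !entry13 => /oppr_inj Et3.
have := congr1 (fun A => entry A 1 4) eqY; rewrite !entry14 Et1 Et3.
by move=> /addrI /oppr_inj ->.
Qed.

Lemma YM t1 t3 t4 s1 s3 s4 :
  (Y cardF t1 t3 t4 * Y cardF s1 s3 s4)%g =
  Y cardF (t1 + s1) (t3 + s3 - t1 * frob m s1)
    (t4 + s4 - t3 * s1 - t1 * t1 * frob m s1 + t1 * (s1 * frob m s1)).
Proof. by apply/val_inj; rewrite [LHS](Ymx_mul cardF). Qed.

Lemma mem_Usyl t1 t3 t4 : Y cardF t1 t3 t4 \in Usyl cardF.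
Proof. by apply/imsetP; exists (t1, t3, t4). Qed.

Lemma UsylP u :
  reflect (exists t1 t3 t4, u = Y cardF t1 t3 t4) (u \in Usyl cardF).
Proof.
apply: (iffP imsetP) => [[[[t1 t3] t4] _ ->]|[t1 [t3 [t4 ->]]]].
  by exists t1, t3, t4.
by exists (t1, t3, t4).
Qed.

Lemma Y0 : Y cardF 0 0 0 = 1%g.
Proof. by apply/val_inj; rewrite /= Ymx0. Qed.

Lemma sum_Usyl (V : nmodType) (f : {'GL_8[F]} -> V) :
  \sum_(u in Usyl cardF) f u = \sum_t1 \sum_t3 \sum_t4 f (Y cardF t1 t3 t4).
Proof.
rewrite big_imset /=; last by move=> s t _ _; apply: Y_inj.
by rewrite pair_big pair_big.
Qed.

(** Writing conjugacy as x r = r s involves products only, so the multiplication law [YM] suffices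
    and no coordinate formula for inverses is needed. *)
Lemma Y_conjP t1 t3 t4 s1 s3 s4 : reflect
  (exists r1 r3 r4, (Y cardF t1 t3 t4 * Y cardF r1 r3 r4)%g =
                    (Y cardF r1 r3 r4 * Y cardF s1 s3 s4)%g)
  (Y cardF s1 s3 s4 \in (Y cardF t1 t3 t4 ^: Usyl cardF)%g).
Proof.
apply: (iffP imsetP) => [[_ /UsylP[r1 [r3 [r4 ->]]] ->]|[r1 [r3 [r4 eqr]]]].
  by exists r1, r3, r4; rewrite -conjgC.
by exists (Y cardF r1 r3 r4); rewrite ?mem_Usyl // conjgE eqr mulKg.
Qed.

End FrobeniusTwist.

(** * Coordinates on the space V *)

Section RowVectors.
Variable F : finFieldType.
Implicit Types b : F.

Definition rowV b2 b3 b4 : 'M[F]_8 :=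
  b2 *: e F 1 2 + b3 *: e F 1 3 + b4 *: e F 1 4.

Lemma entry_rowV b2 b3 b4 :
  [/\ entry (rowV b2 b3 b4) 1 2 = b2, entry (rowV b2 b3 b4) 1 3 = b3
    & entry (rowV b2 b3 b4) 1 4 = b4].
Proof.
by split; rewrite /entry !mxE -!(inj_eq val_inj) /= !inordK //=
  !(mulr0, mulr1, addr0, add0r).
Qed.

Lemma rowV_inj : injective (fun b : F * F * F => rowV b.1.1 b.1.2 b.2).
Proof.
move=> [[b2 b3] b4] [[c2 c3] c4] /= eq_bc.
have [b2E b3E b4E] := entry_rowV b2 b3 b4.
have [] := entry_rowV c2 c3 c4.
by rewrite -eq_bc b2E b3E b4E => -> -> ->.
Qed.

Lemma delta_mulE (p n r : nat) (C : 'M[F]_(n, r)) (i : 'I_p) j k :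
  (delta_mx i j *m C) i k = C j k.
Proof.
rewrite mxE (bigD1 j) //= big1 ?addr0 => [|l /negPf neq_lj].
  by rewrite mxE !eqxx mul1r.
by rewrite mxE eqxx neq_lj mul0r.
Qed.

Lemma kappa_delta i j (C : 'M[F]_8) : kappa (delta_mx i j) C = C i j.
Proof.
rewrite /kappa trmx_delta /mxtrace (bigD1 j) //= delta_mulE big1 ?addr0 //.
move=> k /negPf neq_kj; rewrite mxE big1 // => l _.
by rewrite mxE neq_kj mul0r.
Qed.

Lemma kappa_rowV b2 b3 b4 (C : 'M[F]_8) :
  kappa (rowV b2 b3 b4) (projV C) =
    b2 * entry C 1 2 + b3 * entry C 1 3 + b4 * entry C 1 4.
Proof.
have [e2 e3 e4] := entry_rowV (entry C 1 2) (entry C 1 3) (entry C 1 4).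
have kappaD A B D : kappa (A + B) D = kappa A D + kappa B D :> F.
  by rewrite /kappa linearD mulmxDl mxtraceD.
have kappaZ a A D : kappa (a *: A) D = a * kappa A D :> F.
  by rewrite /kappa linearZ -scalemxAl mxtraceZ.
transitivity (b2 * entry (projV C) 1 2 + b3 * entry (projV C) 1 3
              + b4 * entry (projV C) 1 4); last by rewrite /projV e2 e3 e4.
by rewrite /rowV !kappaD !kappaZ !kappa_delta.
Qed.

Lemma entry_rowV_mul b2 b3 b4 (C : 'M[F]_8) k :
  entry (rowV b2 b3 b4 *m C^T) 1 k =
    b2 * entry C k 2 + b3 * entry C k 3 + b4 * entry C k 4.
Proof.
rewrite /rowV !mulmxDl -!scalemxAl /entry.
rewrite [LHS]mxE [X in X + _]mxE [X in X + _ + _]mxE [X in _ + X + _]mxE.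
by rewrite [X in _ + _ + X]mxE !delta_mulE !mxE.
Qed.

End RowVectors.

(** * Sums of a nontrivial additive character *)

Section Vartheta.
Variables (F : finFieldType) (vartheta : 'CF([set: F])).
Hypothesis lin_vartheta : vartheta \is a linear_char.
Hypothesis nontrivial_vartheta : vartheta != 1.

Lemma varthetaD x y : vartheta (x + y) = vartheta x * vartheta y.
Proof. by rewrite -lin_charM ?inE. Qed.

Lemma vartheta0 : vartheta 0 = 1.
Proof. exact: lin_char1. Qed.

Lemma varthetaN x : vartheta (- x) = (vartheta x)^*.
Proof. by rewrite -lin_charV_conj ?inE. Qed.

(** If [vartheta a != 1], translating x by a / c multiplies the sum by [vartheta a], so the sum
    vanishes. The offset [d] carries the contribution of the coordinates held fixed in a multiple
    sum. *)
Lemma sum_vartheta c d : c != 0 -> \sum_x vartheta (d + c * x) = 0.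
Proof.
move=> c0; have [a vartheta_a] : exists a, vartheta a != 1.
  apply/existsP; apply: contraNT nontrivial_vartheta.
  rewrite negb_exists => /forallP vartheta1.
  apply/eqP/cfunP=> x; rewrite cfun1E inE /=.
  by have := vartheta1 x; rewrite negbK => /eqP.
suff: (1 - vartheta a) * \sum_x vartheta (d + c * x) = 0.
  by move/eqP; rewrite mulf_eq0 subr_eq0 eq_sym (negPf vartheta_a) => /eqP.
rewrite mulrBl mul1r; apply/eqP; rewrite subr_eq0; apply/eqP.
rewrite [LHS](reindex_inj (addrI (a / c))) big_distrr /=; apply: eq_bigr => x _.
by rewrite -varthetaD mulrDr mulrCA divff // mulr1 addrCA.
Qed.

End Vartheta.

(** * Bases of the orbit modules and their traces *)

Section OrbitCharacters.
Variables (m : nat) (F : finFieldType).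
Hypothesis cardF : #|F| = (3 ^ (2 * m + 1))%N.
Variable vartheta : 'CF([set: F]).
Hypothesis lin_vartheta : vartheta \is a linear_char.
Hypothesis nontrivial_vartheta : vartheta != 1.
Let U := Usyl cardF.

Lemma chiV_Y b2 b3 b4 t1 t3 t4 :
  chiV vartheta (rowV b2 b3 b4) (Y cardF t1 t3 t4) =
    vartheta (b2 * t1 - b3 * t3 + b4 * (t1 * t3 - t4)).
Proof.
by rewrite /chiV kappa_rowV /= (entry12 cardF) (entry13 cardF) (entry14 cardF)
  mulrN.
Qed.

(** Since A.u is defined with the inverse transpose of u, acting by an inverse uses the known
    entries of [Y] directly. Rows 1 to 4 of the matrix are unitriangular, and only the entries 23,
    24, 34 contribute. *)
Lemma actV_YV b2 b3 b4 t1 t3 t4 :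
  actV (rowV b2 b3 b4) (Y cardF t1 t3 t4)^-1 =
    rowV (b2 + b3 * frob m t1 + b4 * (frob m t1 * t1 + t3)) (b3 + b4 * t1) b4.
Proof.
rewrite /actV invgK /projV !entry_rowV_mul /= !(entry_diag cardF).
rewrite (entry23 cardF) (entry24 cardF) (entry34 cardF) !(entry_lower cardF) //.
by rewrite !(mulr0, mulr1, addr0, add0r).
Qed.

(** The summand is [vartheta] of an expression affine in t4 with coefficient a4 - b4. If that
    coefficient vanishes, so does the mixed term t1 t3, and the expression is linear in t3 with
    coefficient a3 - b3; if this vanishes too, only t1 is left. The coordinate with the first
    nonzero coefficient is summed innermost. *)
Lemma chiV_orthogonal A B : projV A = A -> projV B = B ->
  \sum_(u in U) (chiV vartheta A u)^* * chiV vartheta B u =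
    if A == B then #|U|%:R else 0.
Proof.
have conjM x y : (vartheta x)^* * vartheta y = vartheta (y - x).
  by rewrite (varthetaD lin_vartheta) (varthetaN lin_vartheta) mulrC.
case: eqP => [<- _ _|neqAB].
  rewrite -sum1_card natr_sum; apply: eq_bigr => u _.
  by rewrite /chiV conjM subrr (vartheta0 lin_vartheta).
rewrite -[projV A]/(rowV _ _ _) -[projV B]/(rowV _ _ _).
move: (entry A 1 2) (entry A 1 3) (entry A 1 4) => a2 a3 a4 defA.
move: (entry B 1 2) (entry B 1 3) (entry B 1 4) => b2 b3 b4 defB.
rewrite sum_Usyl -defA -defB.
under eq_bigr do under eq_bigr do under eq_bigr do rewrite !chiV_Y conjM.
have [eq4|neq4] := eqVneq b4 a4; last first.
  apply: big1 => t1 _; apply: big1 => t3 _.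
  rewrite -[RHS](@sum_vartheta _ _ lin_vartheta nontrivial_vartheta (a4 - b4)
    ((b2 - a2) * t1 - (b3 - a3) * t3 + (b4 - a4) * (t1 * t3))).
    by apply: eq_bigr => t4 _; congr (vartheta _); ring.
  by rewrite subr_eq0 eq_sym.
have [eq3|neq3] := eqVneq b3 a3; last first.
  apply: big1 => t1 _; rewrite exchange_big; apply: big1 => t4 _.
  rewrite -[RHS](@sum_vartheta _ _ lin_vartheta nontrivial_vartheta (a3 - b3)
    ((b2 - a2) * t1)).
    by apply: eq_bigr => t3 _; congr (vartheta _); rewrite eq4; ring.
  by rewrite subr_eq0 eq_sym.
have neq2 : b2 - a2 != 0.
  rewrite subr_eq0; apply/eqP => eq2; apply: neqAB.
  by rewrite -defA -defB eq2 eq3 eq4.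
rewrite exchange_big; apply: big1 => t3 _; rewrite exchange_big.
apply: big1 => t4 _.
rewrite -[RHS](sum_vartheta lin_vartheta nontrivial_vartheta 0 neq2).
by apply: eq_bigr => t1 _; congr (vartheta _); rewrite eq4 eq3; ring.
Qed.

Definition orbitV (A : 'M[F]_8) : {set 'M[F]_8} := [set actV A u | u in U].

Lemma projV_orbitV A B : B \in orbitV A -> projV B = B.
Proof. by case/imsetP=> u _ ->; rewrite projVK. Qed.

(** The rows are indexed by the orbit, not by the group: each orbit point occurs once, which makes
    linear independence possible. *)
Let bracket_mx A :=
  \matrix_(i < #|orbitV A|) bracket vartheta U (enum_val i).

(** The matrix [Z] of values of the [chiV] is a right inverse: the entries of the product are the
    sums of [chiV_orthogonal], normalised by the factor 1/|U| in [bracket]. *)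
Let bracket_mx_free A : row_free (bracket_mx A).
Proof.
pose Z := \matrix_(x < #|U|) \row_(j < #|orbitV A|)
  chiV vartheta (enum_val j) (enum_val x).
apply/row_freeP; exists Z; apply/row_matrixP=> i; rewrite row_mul rowK row1.
have Ai := projV_orbitV (enum_valP i).
rewrite /bracket -scalemxAl mulmx_suml; apply/rowP=> j.
have Aj := projV_orbitV (enum_valP j).
have U0 : #|U|%:R != 0 :> algC by rewrite pnatr_eq0 -lt0n cardG_gt0.
rewrite mxE summxE (eq_bigr (fun u => (chiV vartheta (enum_val i) u)^* *
    chiV vartheta (enum_val j) u)) => [|u Uu]; last first.
  by rewrite -scalemxAl mxE -rowE rowK mxE gring_indexK.
rewrite chiV_orthogonal // (inj_eq enum_val_inj) mxE eqxx eq_sym /=.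
by case: eqP => _; rewrite ?mulVf ?mulr0.
Qed.

Let bracket_mx_span A : (bracket_mx A :=: orbit_module vartheta U A)%MS.
Proof.
apply/eqmxP/andP; split.
  apply/row_subP=> i; rewrite rowK.
  have /imsetP[u Uu ->] := enum_valP i.
  by apply: (sumsmx_sup u); rewrite ?genmxE.
apply/sumsmx_subP=> u Uu; rewrite genmxE.
have Au : actV A u \in orbitV A by apply: imset_f.
rewrite (_ : bracket _ _ _ = row (enum_rank_in Au (actV A u)) (bracket_mx A)).
  exact: row_sub.
by rewrite rowK enum_rankK_in.
Qed.

Lemma actV_orbitV A B u : projV A = A -> B \in orbitV A -> u \in U ->
  actV B u \in orbitV A.
Proof.
move=> VA /imsetP[v Uv ->] Uu.
by rewrite -(actV_mul (@Usyl_unitriangular _ _ cardF)) // imset_f ?groupM.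
Qed.

(* On the basis [B], B in the orbit of A, the module is monomial. *)
Lemma orbit_charE A (VA : projV A = A) u : u \in U ->
  cfRepr (submod_repr (orbit_moduleP (@Usyl_unitriangular _ _ cardF)
    lin_vartheta VA)) u =
  \sum_(B in orbitV A | actV B u == B) (chiV vartheta B u^-1)^*.
Proof.
move=> Uu; rewrite cfunE Uu mulr1n.
pose P : 'M[algC]_#|orbitV A| := \matrix_(i, j)
  ((chiV vartheta (enum_val i) u^-1)^* *+ (actV (enum_val i) u == enum_val j)).
rewrite [submod_repr _ u]/= /submod_mx.
rewrite (@mxtrace_submod _ _ _ _ _ (bracket_mx A) P) //; last first.
  apply/row_matrixP=> i; rewrite row_mul rowK.
  have Oi := enum_valP i; have Oiu := actV_orbitV VA Oi Uu.
  rewrite (bracket_mul (@Usyl_unitriangular _ _ cardF) lin_vartheta) //;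
    last exact: projV_orbitV Oi.
  rewrite row_mul mulmx_sum_row
    (bigD1 (enum_rank_in Oiu (actV (enum_val i) u))) //=.
  rewrite !mxE enum_rankK_in // eqxx mulr1n rowK enum_rankK_in // big1 ?addr0 //.
  move=> j /negPf neq_j; rewrite !mxE; case: eqP => [eq_j|];
    last by rewrite scale0r.
  by case/eqP: (negbT neq_j); apply: enum_val_inj; rewrite enum_rankK_in.
rewrite /mxtrace [RHS]big_enum_val_cond /= [RHS]big_mkcond /=.
by apply: eq_bigr => i _; rewrite mxE; case: eqP.
Qed.

End OrbitCharacters.

(** * Orbits, fixed points and character values *)

Section OrbitCharacterTable.
Variables (m : nat) (F : finFieldType).
Hypothesis cardF : #|F| = (3 ^ (2 * m + 1))%N.
Variable vartheta : 'CF([set: F]).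
Hypothesis lin_vartheta : vartheta \is a linear_char.
Hypothesis nontrivial_vartheta : vartheta != 1.
Let U := Usyl cardF.
Let Uuni := @Usyl_unitriangular _ _ cardF.

Lemma actV1 (A : 'M[F]_8) : projV A = A -> actV A 1 = A.
Proof. by move=> VA; rewrite /actV invg1 GL_1E trmx1 mulmx1. Qed.

Lemma actV_fixV A u : projV A = A -> u \in U ->
  (actV A u^-1 == A) = (actV A u == A).
Proof.
move=> VA Uu; apply/eqP/eqP => fixA.
  by rewrite -[in LHS]fixA -(actV_mul Uuni) ?groupV // mulVg actV1.
by rewrite -[in LHS]fixA -(actV_mul Uuni) ?groupV // mulgV actV1.
Qed.

(** On the stabiliser of A the cocycle identity [kappa_mul] becomes additivity, so [chiV] is
    multiplicative there and inversion is conjugation. *)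
Lemma chiV_fixV A u : projV A = A -> u \in U -> actV A u^-1 = A ->
  (chiV vartheta A u^-1)^* = chiV vartheta A u.
Proof.
move=> VA Uu fixA; rewrite /chiV -(varthetaN lin_vartheta); congr (vartheta _).
(* At u = 1 the identity reads k = k + k. *)
have kappa1 : kappa A (projV (GLval (1%g : {'GL_8[F]}))) = 0.
  have := kappa_mul Uuni VA (group1 _) (group1 _).
  by rewrite mulg1 invg1 actV1 // -[LHS]addr0 => /addrI.
apply/eqP; rewrite eq_sym -addr_eq0 addrC.
have := kappa_mul Uuni VA (groupVr Uu) Uu.
by rewrite mulVg kappa1 fixA => <-.
Qed.

(** Inverses are moved from [chiV] to the fixed-point condition, so that [chiV_Y] and [actV_YV]
    express both in the coordinates of u. *)
Lemma orbit_char_sum (B : subvs_of (V F)) u : u \in U ->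
  orbit_char cardF lin_vartheta B u =
  \sum_(A in orbitV cardF (vsval B) | actV A u^-1 == A) chiV vartheta A u.
Proof.
move=> Uu.
rewrite /orbit_char (orbit_charE lin_vartheta nontrivial_vartheta) //.
apply: eq_big => A.
  have [/projV_orbitV VA|] //= := boolP (A \in _).
  by rewrite (actV_fixV VA Uu).
case/andP=> /projV_orbitV VA fixA; apply: chiV_fixV => //.
by apply/eqP; rewrite (actV_fixV VA Uu).
Qed.

Lemma orbitVP b2 b3 b4 B : reflect
  (exists t1 t3, B =
    rowV (b2 + b3 * frob m t1 + b4 * (frob m t1 * t1 + t3)) (b3 + b4 * t1) b4)
  (B \in orbitV cardF (rowV b2 b3 b4)).
Proof.
apply: (iffP imsetP) => [[u Uu ->]|[t1 [t3 ->]]].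
  (* Taking coordinates of the inverse of u makes [actV_YV] applicable; its right-hand side does not
     involve t4. *)
  have /UsylP[t1 [t3 [t4 uV]]] : (u^-1)%g \in U by rewrite groupV.
  by exists t1, t3; rewrite -(actV_YV cardF _ _ _ _ _ t4) -uV invgK.
by exists (Y cardF t1 t3 0)^-1%g; rewrite ?groupV ?mem_Usyl ?actV_YV.
Qed.

(** The orbit is a single point, fixed by every u. *)
Lemma orbit_char12 (B : subvs_of (V F)) b t1 t3 t4 : vsval B = rowV b 0 0 ->
  orbit_char cardF lin_vartheta B (Y cardF t1 t3 t4) = vartheta (b * t1).
Proof.
move=> defB; rewrite orbit_char_sum ?mem_Usyl // defB (big_pred1 (rowV b 0 0)).
  by rewrite chiV_Y !mul0r subr0 addr0.
move=> A; apply/andP/eqP => [[/orbitVP[s1 [s3 ->]] _]|->].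
  by rewrite !mul0r !addr0.
split; first by apply/orbitVP; exists 0, 0; rewrite !mul0r !addr0.
by rewrite actV_YV !mul0r !addr0.
Qed.

(** The orbit consists of the q vectors (c, b, 0), because [frob] is bijective. The inverse of u
    shifts c by b * frob t1: for nonzero t1 nothing is fixed, and for t1 = 0 every point is fixed
    and contributes the same value. *)
Lemma orbit_char13 (B : subvs_of (V F)) b t1 t3 t4 :
  b != 0 -> vsval B = rowV 0 b 0 ->
  orbit_char cardF lin_vartheta B (Y cardF t1 t3 t4) =
    if t1 == 0 then #|F|%:R * vartheta (- b * t3) else 0.
Proof.
move=> b0 defB; rewrite orbit_char_sum ?mem_Usyl // defB.
have -> : orbitV cardF (rowV 0 b 0) = [set rowV c b 0 | c : F].
  apply/setP=> A; apply/orbitVP/imsetP => [[s1 [s3 ->]]|[c _ ->]].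
    by exists (b * frob m s1) => //; rewrite !mul0r !addr0 add0r.
  exists (invF (frob_inj cardF) (c / b)), 0.
  by rewrite f_invF !mul0r !addr0 add0r mulrC divfK.
rewrite big_mkcondr big_imset /=; last first.
  by move=> c d _ _ /(@rowV_inj _ (c, b, 0) (d, b, 0)) [].
under eq_bigr do rewrite chiV_Y actV_YV !mul0r !addr0.
case: eqP => [->|/eqP t1_0]; last first.
  rewrite big1 // => c _; case: eqP => // /(@rowV_inj _ (_, b, 0) (c, b, 0)).
  case=> /eqP; rewrite -subr_eq0 addrC addKr mulf_eq0 (negPf b0) /=.
  by rewrite frob_eq0 (negPf t1_0).
under eq_bigr do rewrite (frob0 m) !mulr0 addr0 eqxx sub0r.
by rewrite sumr_const -mulNr mulr_natl.
Qed.

(** The orbit consists of the q^2 vectors (c, d, b). The inverse of u shifts d by b * t1 and, once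
    t1 = 0, shifts c by b * t3; so there are fixed points only for t1 = t3 = 0, and then all points
    are fixed with equal contributions. *)
Lemma orbit_char14 (B : subvs_of (V F)) b t1 t3 t4 :
  b != 0 -> vsval B = rowV 0 0 b ->
  orbit_char cardF lin_vartheta B (Y cardF t1 t3 t4) =
    if (t1 == 0) && (t3 == 0) then #|F|%:R ^+ 2 * vartheta (- b * t4) else 0.
Proof.
move=> b0 defB; rewrite orbit_char_sum ?mem_Usyl // defB.
have -> : orbitV cardF (rowV 0 0 b) = [set rowV c.1 c.2 b | c : F * F].
  apply/setP=> A; apply/orbitVP/imsetP => [[s1 [s3 ->]]|[[c d] _ ->]].
    by exists (b * (frob m s1 * s1 + s3), b * s1); rewrite //= !mul0r !add0r.
  (* The solution of d = b s1 and c = b (frob s1 * s1 + s3). *)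
  exists (d / b), (c / b - frob m (d / b) * (d / b)) => /=.
  by congr rowV; field.
rewrite big_mkcondr big_imset /=; last first.
  move=> [c d] [c' d'] _ _.
  by move=> /(@rowV_inj _ (c, d, b) (c', d', b)) [-> ->].
under eq_bigr do rewrite chiV_Y actV_YV.
case: eqP => [->|/eqP t1_0] /=; last first.
  rewrite big1 // => -[c d] _ /=.
  case: eqP => // /(@rowV_inj _ (_, _, b) (c, d, b)) [_] /eqP.
  rewrite -subr_eq0 addrC addKr mulf_eq0 (negPf b0) /=.
  by rewrite (negPf t1_0).
under eq_bigr do rewrite (frob0 m) !(mulr0, mul0r, addr0, add0r, sub0r, oppr0).
case: eqP => [->|/eqP t3_0]; last first.
  rewrite big1 // => -[c d] _ /=.
  case: eqP => // /(@rowV_inj _ (_, _, b) (c, d, b)) [] /eqP.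
  by rewrite -subr_eq0 addrC addKr mulf_eq0 (negPf b0) (negPf t3_0).
under eq_bigr do rewrite !mulr0 addr0 eqxx oppr0 add0r.
by rewrite sumr_const card_prod mulrN -mulNr -natrX mulr_natl mulnn.
Qed.

End OrbitCharacterTable.

(** * Superclasses in coordinates *)

Section Superclasses.
Variables (m : nat) (F : finFieldType).
Hypothesis cardF : #|F| = (3 ^ (2 * m + 1))%N.
Let U := Usyl cardF.

Lemma Y_eq t1 t3 t4 s1 s3 s4 :
  Y cardF t1 t3 t4 = Y cardF s1 s3 s4 -> [/\ t1 = s1, t3 = s3 & t4 = s4].
Proof. by move/(@Y_inj _ _ cardF (t1, t3, t4) (s1, s3, s4)) => [-> -> ->]. Qed.

Lemma Y_congr t1 t3 t4 s1 s3 s4 :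
  t1 = s1 -> t3 = s3 -> t4 = s4 -> Y cardF t1 t3 t4 = Y cardF s1 s3 s4.
Proof. by move=> -> -> ->. Qed.

Lemma mem_C0 s1 s3 s4 :
  (Y cardF s1 s3 s4 \in C0 F) = [&& s1 == 0, s3 == 0 & s4 == 0].
Proof.
rewrite inE -(Y0 cardF); apply/eqP/and3P => [/Y_eq[-> -> ->]|] //.
by case=> /eqP-> /eqP-> /eqP->.
Qed.

(** The elements Y(0, 0, t4) are central. *)
Lemma mem_C4 t4 s1 s3 s4 :
  (Y cardF s1 s3 s4 \in C4 cardF t4) = [&& s1 == 0, s3 == 0 & s4 == t4].
Proof.
apply/Y_conjP/and3P => [[r1 [r3 [r4]]]|[/eqP-> /eqP-> /eqP->]].
  rewrite !YM !(add0r, mul0r, subr0, addr0) => /Y_eq[].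
  rewrite -[LHS]addr0 => /addrI <-; rewrite (frob0 m) !(mulr0, subr0, addr0).
  rewrite -[LHS]addr0 => /addrI <-; rewrite addrC => /addrI <-.
  by [].
exists 0, 0, 0.
by rewrite !YM (frob0 m) !(mulr0, mul0r, subr0, addr0, add0r).
Qed.

(** Conjugation changes only the last coordinate, by - t3 * r1, and this runs over all of F since t3
    is nonzero. *)
Lemma mem_C3 t3 s1 s3 s4 : t3 != 0 ->
  (Y cardF s1 s3 s4 \in C3 cardF t3) = (s1 == 0) && (s3 == t3).
Proof.
move=> t3_0; apply/Y_conjP/andP => [[r1 [r3 [r4]]]|[/eqP-> /eqP->]].
  rewrite !YM !(add0r, mul0r, subr0, addr0) => /Y_eq[].
  rewrite -[LHS]addr0 => /addrI <-; rewrite (frob0 m) !(mulr0, subr0, addr0).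
  by rewrite addrC => /addrI <-.
exists (- s4 / t3), 0, 0; rewrite !YM (frob0 m).
by apply: Y_congr;
  rewrite ?(mulr0, mul0r, subr0, addr0, add0r) // mulrC divfK ?opprK.
Qed.

(** Conjugation preserves t1 and moves the second coordinate within a coset of the image of
    [varsigma m t1]. The transversal meets every such coset, and r3 then adjusts the last coordinate
    freely because t1 is nonzero. *)
Lemma mem_C1 (T : F -> {set F}) t1 s1 s3 s4 : t1 != 0 ->
    varsigma_transversal m t1 (T t1) ->
  (Y cardF s1 s3 s4 \in C1 cardF T t1) = (s1 == t1).
Proof.
move=> t1_0 /and3P[_ _ /forallP transT].
apply/bigcupP/eqP => [[t3 _ /Y_conjP[r1 [r3 [r4]]]]|->].
  by rewrite !YM => /Y_eq[]; rewrite addrC => /addrI <-.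
have /implyP := transT ((varsigma m t1 @: [set: F]) :* s3)%g.
rewrite -{1}rcosetE imset_f ?inE // => /(_ isT)/eqP cardTs3.
have /card_gt0P[t3] : (0 < #|T t1 :&: ((varsigma m t1 @: [set: F]) :* s3)%g|)%N.
  by rewrite cardTs3.
rewrite inE => /andP[Tt3 /rcosetP[_ /imsetP[r1 _ ->] def_t3]].
exists t3 => //; apply/Y_conjP.
(* The middle coordinate r3 is solved from the equation of last coordinates, where it occurs with
   coefficient t1. *)
exists r1, ((s4 + t3 * r1 + t1 * t1 * frob m r1 - t1 * (r1 * frob m r1)
   - r1 * r1 * frob m t1 + r1 * (t1 * frob m t1)) / t1), 0.
(* The group law of the cosets is the addition of F. *)
rewrite !YM; have {}def_t3 : t3 = varsigma m t1 r1 + s3 := def_t3.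
apply: Y_congr; first exact: addrC.
  by rewrite def_t3 /varsigma -!/(frob m _); ring.
by field.
Qed.

Lemma class_Usyl t1 t3 t4 : (Y cardF t1 t3 t4 ^: U)%g \subset U.
Proof. by rewrite class_subG ?mem_Usyl. Qed.

End Superclasses.

(** * Indexed families and the supercharacter axioms *)

Section Supercharacters.
Variables (m : nat) (F : finFieldType).
Hypothesis cardF : #|F| = (3 ^ (2 * m + 1))%N.
Variable vartheta : 'CF([set: F]).
Hypothesis lin_vartheta : vartheta \is a linear_char.
Hypothesis nontrivial_vartheta : vartheta != 1.
Variable T : F -> {set F}.
Hypothesis transT : forall t, t != 0 -> varsigma_transversal m t (T t).
Let U := Usyl cardF.

(* [inl (inl a)], [inl (inr a)] and [inr a] stand for the pairs of indices
   (A_12, t_1), (A_13, t_3) and (A_14, t_4); [inl (inl 0)] stands for M(0) and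
   C_0. *)
Definition index_set : {set F + F + F} :=
  [set i : F + F + F | match i with
    | inl (inl _) => true | inl (inr a) => a != 0 | inr a => a != 0 end].

Definition superclass_index (t1 t3 t4 : F) : F + F + F :=
  if t1 != 0 then inl (inl t1) else if t3 != 0 then inl (inr t3) else
  if t4 != 0 then inr t4 else inl (inl 0).

Definition superclass (i : F + F + F) : {set {'GL_8[F]}} :=
  match i with
  | inl (inl a) => if a == 0 then C0 F else C1 cardF T a
  | inl (inr a) => C3 cardF a
  | inr a => C4 cardF a
  end.

Definition supercharacter (i : F + F + F) : 'CF(U) :=
  orbit_char cardF lin_vartheta
  match i with
  | inl (inl a) => a *: e12 F
  | inl (inr a) => a *: e13 F
  | inr a => a *: e14 F
  end.

Definition supercharacter_value (i : F + F + F) (t1 t3 t4 : F) : algC :=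
  match i with
  | inl (inl a) => vartheta (a * t1)
  | inl (inr a) => if t1 == 0 then #|F|%:R * vartheta (- a * t3) else 0
  | inr a =>
      if (t1 == 0) && (t3 == 0) then #|F|%:R ^+ 2 * vartheta (- a * t4) else 0
  end.

Lemma superclass_index_in t1 t3 t4 : superclass_index t1 t3 t4 \in index_set.
Proof. by rewrite inE /superclass_index; do 3?case: ifP. Qed.

(** Each class becomes a fibre of [superclass_index]; covering, disjointness and constancy of the
    characters are read off from this. *)
Lemma mem_superclass i t1 t3 t4 : i \in index_set ->
  (Y cardF t1 t3 t4 \in superclass i) = (superclass_index t1 t3 t4 == i).
Proof.
rewrite inE /superclass_index; case: i => [[a|a]|a] i_S /=.
- case: ifP => [/eqP->|/negbT a0].
    rewrite mem_C0; case: eqP => [->|/eqP t10] /=; last first.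
      by apply/esym; apply: contraNF t10 => /eqP[->].
    by do 2!case: eqP => //=; rewrite eqxx.
  rewrite mem_C1 ?transT //; have [->|t10] /= := eqVneq t1 0; last first.
    by apply/eqP/eqP => [->|[]].
  rewrite eq_sym (negPf a0); do 2?case: ifP => // _.
  by apply/esym; apply: contraNF a0 => /eqP[->].
- rewrite mem_C3 //; have [->|t10] //= := eqVneq t1 0.
  have [->|t30] /= := eqVneq t3 0; last by apply/eqP/eqP => [->|[]].
  by rewrite eq_sym (negPf i_S); case: ifP.
rewrite mem_C4; have [->|t10] //= := eqVneq t1 0.
have [->|t30] //= := eqVneq t3 0.
have [->|t40] /= := eqVneq t4 0; last by apply/eqP/eqP => [->|[]].
by rewrite eq_sym (negPf i_S).
Qed.

Lemma superclass_sub i : superclass i \subset U.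
Proof.
case: i => [[a|a]|a]; rewrite /superclass ?class_Usyl //.
case: ifP => _; first by rewrite sub1set group1.
by apply/bigcupsP=> t3 _; apply: class_Usyl.
Qed.

Lemma superclassP i u : i \in index_set -> reflect
  (exists t1 t3 t4, u = Y cardF t1 t3 t4 /\ superclass_index t1 t3 t4 = i)
  (u \in superclass i).
Proof.
move=> i_S; apply: (iffP idP) => [ui|[t1 [t3 [t4 [-> /eqP]]]]].
  have /UsylP[t1 [t3 [t4 def_u]]] := subsetP (superclass_sub i) u ui.
  by exists t1, t3, t4; split=> //; apply/eqP; rewrite -mem_superclass -?def_u.
by rewrite mem_superclass.
Qed.

Lemma superclass_neq0 i : i \in index_set -> superclass i != set0.
Proof.
move=> i_S; suff [t1 [t3 [t4 ti]]] :
    exists t1 t3 t4, superclass_index t1 t3 t4 = i.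
  by apply/set0Pn; exists (Y cardF t1 t3 t4); rewrite mem_superclass ?ti.
move: i_S; rewrite inE; case: i => [[a|a]|a].
- exists a, 0, 0; rewrite /superclass_index eqxx /=.
  by case: eqP => [->|].
- by move=> a0; exists 0, a, 0; rewrite /superclass_index eqxx a0.
by move=> a0; exists 0, 0, a; rewrite /superclass_index eqxx a0.
Qed.

Lemma superclass_trivI i j u : i \in index_set -> j \in index_set ->
  u \in superclass i -> u \in superclass j -> i = j.
Proof.
move=> i_S j_S /(superclassP _ i_S)[t1 [t3 [t4 [-> <-]]]].
by rewrite mem_superclass // => /eqP.
Qed.

Lemma superclass_inj : {in index_set &, injective superclass}.
Proof.
move=> i j i_S j_S eq_ij; have /set0Pn[u ui] := superclass_neq0 i_S.
by apply: (superclass_trivI i_S j_S ui); rewrite -eq_ij.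
Qed.

Lemma superclass_partition : partition (superclass @: index_set) U.
Proof.
apply/and3P; split.
- rewrite eqEsubset; apply/andP; split.
    by apply/bigcupsP=> _ /imsetP[i _ ->]; apply: superclass_sub.
  apply/subsetP=> _ /UsylP[t1 [t3 [t4 ->]]]; apply/bigcupP.
  exists (superclass (superclass_index t1 t3 t4)).
    exact/imset_f/superclass_index_in.
  by rewrite mem_superclass ?superclass_index_in.
- apply/trivIsetP=> _ _ /imsetP[i i_S ->] /imsetP[j j_S ->] neq_ij.
  rewrite -setI_eq0; apply: contraNT neq_ij => /set0Pn[u /setIP[ui uj]].
  by rewrite (superclass_trivI i_S j_S ui uj).
by apply/imsetP=> -[i i_S /esym/eqP]; rewrite (negPf (superclass_neq0 i_S)).
Qed.

Lemma supercharacterE i t1 t3 t4 : i \in index_set ->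
  supercharacter i (Y cardF t1 t3 t4) = supercharacter_value i t1 t3 t4.
Proof.
rewrite inE; case: i => [[a|a]|a] i_S /=.
- rewrite (@orbit_char12 _ _ cardF _ lin_vartheta nontrivial_vartheta _ a) //.
  by rewrite linearZ /= /rowV !scale0r !addr0.
- rewrite (@orbit_char13 _ _ cardF _ lin_vartheta nontrivial_vartheta _ a) //.
  by rewrite linearZ /= /rowV !scale0r addr0 add0r.
rewrite (@orbit_char14 _ _ cardF _ lin_vartheta nontrivial_vartheta _ a) //.
by rewrite linearZ /= /rowV !scale0r !add0r.
Qed.

Lemma supercharacter_value_index i t1 t3 t4 s1 s3 s4 :
  superclass_index t1 t3 t4 = superclass_index s1 s3 s4 ->
  supercharacter_value i t1 t3 t4 = supercharacter_value i s1 s3 s4.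
Proof.
(* The value at the representative of class [k] that has at most one nonzero coordinate. *)
pose value k := match k with
  | inl (inl r1) => supercharacter_value i r1 0 0
  | inl (inr r3) => supercharacter_value i 0 r3 0
  | inr r4 => supercharacter_value i 0 0 r4 end.
suff valueE r1 r3 r4 :
    supercharacter_value i r1 r3 r4 = value (superclass_index r1 r3 r4).
  by rewrite !valueE => ->.
rewrite /superclass_index.
have [->|r10] := eqVneq r1 0; last first.
  by case: i @value => [[a|a]|a] /=; rewrite ?(negPf r10).
have [->|r30] := eqVneq r3 0; last first.
  by case: i @value => [[a|a]|a] /=; rewrite ?(negPf r30) ?andbF.
by have [->|r40] := eqVneq r4 0.
Qed.

(** The value at the identity is the degree 1, q or q^2. *)
Lemma supercharacter_neq0 i : i \in index_set -> supercharacter i != 0.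
Proof.
move=> i_S; apply: contraTneq (oner_neq0 algC) => chi0.
have q0 : #|F|%:R != 0 :> algC.
  by rewrite pnatr_eq0 -lt0n; apply/card_gt0P; exists 0.
have: supercharacter i (Y cardF 0 0 0) = 0 by rewrite chi0 cfunE.
rewrite supercharacterE //; case: i {i_S chi0} => [[a|a]|a] /=;
  rewrite ?eqxx /= mulr0 (vartheta0 lin_vartheta) => /eqP; rewrite ?mulr1.
- by move=> ->.
- by rewrite (negPf q0).
by rewrite expf_eq0 (negPf q0).
Qed.

Lemma sum_vartheta_scale k c d : c != 0 -> \sum_x k * vartheta (d + c * x) = 0.
Proof.
move=> c0; rewrite -big_distrr /=.
by rewrite (sum_vartheta lin_vartheta nontrivial_vartheta) ?mulr0.
Qed.

(** For two types, the coordinate of the later type is summed innermost, with its nonzero index as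
    coefficient; for equal types the coefficient is, up to sign, the difference of the indices.
    Where one factor vanishes the sum is zero trivially. *)
Lemma supercharacter_orthogonal i j : i \in index_set -> j \in index_set ->
  i != j -> '[supercharacter i, supercharacter j] = 0.
Proof.
pose dot (f g : F -> F -> F -> algC) :=
  \sum_t1 \sum_t3 \sum_t4 f t1 t3 t4 * (g t1 t3 t4)^*.
move=> i_S j_S neq_ij; rewrite cfdotE sum_Usyl.
suff: dot (supercharacter_value i) (supercharacter_value j) = 0.
  rewrite /dot; under eq_bigr do under eq_bigr do under eq_bigr do
    rewrite -(supercharacterE _ _ _ i_S) -(supercharacterE _ _ _ j_S).
  by move=> ->; rewrite mulr0.
(* Hermitian symmetry leaves six of the nine pairs of types. *)
have dotC f g : dot f g = (dot g f)^*.
  rewrite /dot rmorph_sum; apply: eq_bigr => t1 _.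
  rewrite rmorph_sum; apply: eq_bigr => t3 _.
  rewrite rmorph_sum; apply: eq_bigr => t4 _.
  by rewrite rmorphM /= conjCK mulrC.
have conjM x y : vartheta x * (vartheta y)^* = vartheta (x - y).
  by rewrite (varthetaD lin_vartheta) (varthetaN lin_vartheta).
pose q : algC := #|F|%:R.
have dot11 a b : a != b ->
  dot (supercharacter_value (inl (inl a)))
    (supercharacter_value (inl (inl b))) = 0.
  move=> neq_ab; rewrite /dot exchange_big; apply: big1 => t3 _.
  rewrite exchange_big; apply: big1 => t4 _ /=.
  rewrite -[RHS](@sum_vartheta_scale 1 (a - b) 0) ?subr_eq0 //.
  apply: eq_bigr => t1 _; rewrite conjM mul1r.
  by congr (vartheta _); ring.
have dot13 a b : b != 0 ->
  dot (supercharacter_value (inl (inl a)))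
    (supercharacter_value (inl (inr b))) = 0.
  move=> b0; apply: big1 => t1 _; rewrite exchange_big; apply: big1 => t4 _ /=.
  case: eqP => _; last by apply: big1 => t3 _; rewrite conjC0 mulr0.
  rewrite -[RHS](@sum_vartheta_scale q b (a * t1)) //.
  apply: eq_bigr => t3 _; rewrite rmorphM /= conjC_nat mulrCA conjM.
  by congr (_ * vartheta _); ring.
have dot14 a b : b != 0 ->
  dot (supercharacter_value (inl (inl a))) (supercharacter_value (inr b)) = 0.
  move=> b0; apply: big1 => t1 _; apply: big1 => t3 _ /=.
  case: andP => _; last by apply: big1 => t4 _; rewrite conjC0 mulr0.
  rewrite -[RHS](@sum_vartheta_scale (q ^+ 2) b (a * t1)) //.
  apply: eq_bigr => t4 _; rewrite rmorphM /= rmorphXn /= conjC_nat mulrCA conjM.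
  by congr (_ * vartheta _); ring.
have dot33 a b : a != b ->
  dot (supercharacter_value (inl (inr a)))
    (supercharacter_value (inl (inr b))) = 0.
  move=> neq_ab; apply: big1 => t1 _; rewrite exchange_big.
  apply: big1 => t4 _ /=.
  case: eqP => _; last by apply: big1 => t3 _; rewrite mul0r.
  rewrite -[RHS](@sum_vartheta_scale (q * q) (b - a) 0)
    ?subr_eq0 1?eq_sym //.
  apply: eq_bigr => t3 _; rewrite rmorphM /= conjC_nat mulrACA conjM.
  by congr (_ * vartheta _); ring.
have dot34 a b : b != 0 ->
  dot (supercharacter_value (inl (inr a))) (supercharacter_value (inr b)) = 0.
  move=> b0; apply: big1 => t1 _; apply: big1 => t3 _ /=.
  case: eqP => _ /=; last by apply: big1 => t4 _; rewrite mul0r.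
  case: eqP => _; last by apply: big1 => t4 _; rewrite conjC0 mulr0.
  rewrite -[RHS](@sum_vartheta_scale (q * q ^+ 2) b (- a * t3)) //.
  apply: eq_bigr => t4 _; rewrite rmorphM /= rmorphXn /= conjC_nat.
  rewrite mulrACA conjM.
  by congr (_ * vartheta _); ring.
have dot44 a b : a != b ->
  dot (supercharacter_value (inr a)) (supercharacter_value (inr b)) = 0.
  move=> neq_ab; apply: big1 => t1 _; apply: big1 => t3 _ /=.
  case: andP => _; last by apply: big1 => t4 _; rewrite mul0r.
  rewrite -[RHS](@sum_vartheta_scale (q ^+ 2 * q ^+ 2) (b - a) 0)
    ?subr_eq0 1?eq_sym //.
  apply: eq_bigr => t4 _; rewrite rmorphM /= rmorphXn /= conjC_nat.
  rewrite mulrACA conjM.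
  by congr (_ * vartheta _); ring.
move: i_S j_S neq_ij; rewrite !inE.
case: i => [[a|a]|a]; case: j => [[b|b]|b] a0 b0 neq_ab.
- by apply: dot11; apply: contraNneq neq_ab => ->.
- exact: dot13.
- exact: dot14.
- by rewrite dotC dot13 ?conjC0.
- by apply: dot33; apply: contraNneq neq_ab => ->.
- exact: dot34.
- by rewrite dotC dot14 ?conjC0.
- by rewrite dotC dot34 ?conjC0.
by apply: dot44; apply: contraNneq neq_ab => ->.
Qed.

(** Equal characters at distinct indices would have norm zero by orthogonality. *)
Lemma supercharacter_inj : {in index_set &, injective supercharacter}.
Proof.
move=> i j i_S j_S eq_ij; apply/eqP; apply: contraT => neq_ij.
have := supercharacter_orthogonal i_S j_S neq_ij.
move/eqP; rewrite -eq_ij cfnorm_eq0.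
by rewrite (negPf (supercharacter_neq0 i_S)).
Qed.

Lemma supercharacter_theory_Usyl :
  supercharacter_theory [fset supercharacter i | i in index_set]%fset
    (superclass @: index_set).
Proof.
split.
- split=> [|_ /imfsetP[i i_S ->]]; first exact: superclass_partition.
  by split; [apply: cfRepr_char | apply: supercharacter_neq0].
(* Both families are injective images of [index_set], hence equinumerous. *)
- rewrite card_in_imfset; last exact: supercharacter_inj.
  by rewrite card_in_imset -?cardE //; apply: superclass_inj.
- move=> _ /imfsetP[i i_S ->] _ /imsetP[j j_S ->] x y.
  move=> /(superclassP _ j_S)[t1 [t3 [t4 [-> tj]]]].
  move=> /(superclassP _ j_S)[s1 [s3 [s4 [-> sj]]]].
  rewrite !supercharacterE //.
  by apply: supercharacter_value_index; rewrite tj sj.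
- move=> _ _ /imfsetP[i i_S ->] /imfsetP[j j_S ->] neq_ij.
  by apply: supercharacter_orthogonal => //; apply: contraNneq neq_ij => ->.
apply/imsetP; exists (inl (inl 0)); first by rewrite inE.
by rewrite /= eqxx.
Qed.

End Supercharacters.

(** * Identification with the stated families and the table *)

Unset Implicit Arguments.
Set Strict Implicit.

Theorem proposition7p4 (m : nat) (F : finFieldType)
    (cardF : #|F| = (3 ^ (2 * m + 1))%N)
    (vartheta : 'CF([set: F])) (lin_vartheta : vartheta \is a linear_char)
    (nontrivial_vartheta : vartheta != 1)
    (T : F -> {set F})
    (transT : forall t, t != 0 -> varsigma_transversal m t (T t)) :
  let q : algC := (3 ^ (2 * m + 1))%:R in
  let U := Usyl cardF in
  let Psi := orbit_char cardF lin_vartheta in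
  let C1 := C1 cardF T in
  let C3 := C3 cardF in
  let C4 := C4 cardF in
  let nonzero : {set F} := [set~ 0]%SET in
  let K : {set {set {'GL_8[F]}}} :=
    ([set C0 F] :|: [set C1 t1 | t1 in nonzero]
     :|: [set C3 t3 | t3 in nonzero] :|: [set C4 t4 | t4 in nonzero])%SET in
  let X : {fset 'CF(U)} :=
    ([fset Psi 0] `|` [fset Psi (a *: e12 F) | a in nonzero]
     `|` [fset Psi (a *: e13 F) | a in nonzero]
     `|` [fset Psi (a *: e14 F) | a in nonzero])%fset in
  let row (chi : 'CF(U)) (v0 : algC) (v1 v3 v4 : F -> algC) : Prop :=
    [/\ forall u, u \in C0 F -> chi u = v0,
        forall t1 u, t1 != 0 -> u \in C1 t1 -> chi u = v1 t1,
        forall t3 u, t3 != 0 -> u \in C3 t3 -> chi u = v3 t3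
      & forall t4 u, t4 != 0 -> u \in C4 t4 -> chi u = v4 t4] in
  supercharacter_theory X K /\
  [/\ row (Psi 0) 1 (fun=> 1) (fun=> 1) (fun=> 1),
      forall a, a != 0 ->
        row (Psi (a *: e12 F)) 1 (fun t1 => vartheta (a * t1)) (fun=> 1) (fun=> 1),
      forall a, a != 0 ->
        row (Psi (a *: e13 F)) q (fun=> 0) (fun t3 => q * vartheta (- a * t3))
          (fun=> q)
    & forall a, a != 0 ->
        row (Psi (a *: e14 F)) (q ^+ 2) (fun=> 0) (fun=> 0)
          (fun t4 => q ^+ 2 * vartheta (- a * t4))].
Proof.
move=> q U Psi D1 D3 D4 nonzero K X row.
have q_F : q = #|F|%:R by rewrite cardF.
(* The first summand of the index type includes 0, which accounts for [C0], and on the character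
   side for [Psi 0]. *)
have K_E : K = superclass cardF T @: index_set F.
  apply/setP=> B; rewrite !inE; apply/idP/imsetP => [|[[[a|a]|a] /[!inE] a_S ->]].
  - case/orP=> [/orP[/orP[/eqP->|/imsetP[a]]|/imsetP[a]]|/imsetP[a]].
    + by exists (inl (inl 0)); rewrite ?inE //= eqxx.
    + by rewrite !inE => a0 ->; exists (inl (inl a)); rewrite ?inE //= (negPf a0).
    + by rewrite !inE => a0 ->; exists (inl (inr a)); rewrite ?inE.
    by rewrite !inE => a0 ->; exists (inr a); rewrite ?inE.
  - rewrite /=; have [_|a0] := eqVneq a 0; first by rewrite eqxx.
    by rewrite (imset_f D1) ?orbT // !inE.
  - by rewrite (imset_f D3) ?orbT // !inE.
  by rewrite (imset_f D4) ?orbT // !inE.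
have Psi0 : Psi 0 = supercharacter cardF lin_vartheta (inl (inl 0)).
  by rewrite /supercharacter scale0r.
have X_E : X = [fset supercharacter cardF lin_vartheta i | i in index_set F]%fset.
  apply/fsetP=> chi; rewrite !in_fsetU in_fset1; apply/idP/imfsetP => /=.
  - case/orP=> [/orP[/orP[/eqP->|/imfsetP[a /=]]|/imfsetP[a /=]]|/imfsetP[a /=]].
    + by exists (inl (inl 0)); rewrite ?inE.
    + by move=> _ ->; exists (inl (inl a)); rewrite ?inE.
    + by rewrite !inE => a0 ->; exists (inl (inr a)); rewrite ?inE.
    by rewrite !inE => a0 ->; exists (inr a); rewrite ?inE.
  case=> -[[a|a]|a] /[!inE] a_S ->.
  - have [->|a0] := eqVneq a 0; first by rewrite Psi0 eqxx.
    apply/orP; left; apply/orP; left; apply/orP; right.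
    by apply/imfsetP; exists a; rewrite //= !inE.
  - apply/orP; left; apply/orP; right.
    by apply/imfsetP; exists a; rewrite //= !inE.
  by apply/orP; right; apply/imfsetP; exists a; rewrite //= !inE.
split.
  by rewrite X_E K_E; apply: supercharacter_theory_Usyl.
(* By constancy on superclasses, each table entry is the value at a representative with at most one
   nonzero coordinate. *)
have rowE i : i \in index_set F ->
    let chi := supercharacter_value vartheta i in
    row (supercharacter cardF lin_vartheta i) (chi 0 0 0)
      (fun t1 => chi t1 0 0) (fun t3 => chi 0 t3 0) (fun t4 => chi 0 0 t4).
  move=> i_S /=.
  have chiE k r1 r3 r4 u : k \in index_set F -> superclass_index r1 r3 r4 = k ->
      u \in superclass cardF T k ->
      supercharacter cardF lin_vartheta i u = supercharacter_value vartheta i r1 r3 r4.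
    move=> k_S rk /(superclassP cardF transT _ k_S)[s1 [s3 [s4 [-> sk]]]].
    rewrite (supercharacterE cardF lin_vartheta nontrivial_vartheta) //.
    by apply: supercharacter_value_index; rewrite sk rk.
  split=> [u u0|t u t0 ut|t u t0 ut|t u t0 ut].
  - by apply: (chiE (inl (inl 0))); rewrite ?inE /superclass_index /= ?eqxx.
  - apply: (chiE (inl (inl t))); rewrite ?inE /superclass_index /= ?t0 //.
    by rewrite (negPf t0).
  - by apply: (chiE (inl (inr t))); rewrite ?inE /superclass_index /= ?eqxx ?t0.
  by apply: (chiE (inr t)); rewrite ?inE /superclass_index /= ?eqxx ?t0.
have v0 := vartheta0 lin_vartheta.
split.
- have [r0 r1 r3 r4] := rowE (inl (inl 0)) ltac:(by rewrite inE).
  rewrite Psi0; split=> [u /r0|t u t0 /(r1 t u t0)|t u t0 /(r3 t u t0)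
    |t u t0 /(r4 t u t0)];
  by rewrite /= ?mul0r v0.
- move=> a a0; have [r0 r1 r3 r4] := rowE (inl (inl a)) ltac:(by rewrite inE).
  split=> [u /r0|t u t0 /(r1 t u t0)|t u t0 /(r3 t u t0)
    |t u t0 /(r4 t u t0)] //=;
  by rewrite /= ?mulr0 ?v0.
- move=> a a0; have [r0 r1 r3 r4] := rowE (inl (inr a)) ltac:(by rewrite inE).
  split=> [u /r0|t u t0 /(r1 t u t0)|t u t0 /(r3 t u t0)
    |t u t0 /(r4 t u t0)] //=;
  by rewrite /= ?eqxx ?(negPf t0) ?mulr0 ?v0 ?mulr1 ?q_F.
move=> a a0; have [r0 r1 r3 r4] := rowE (inr a) ltac:(by rewrite inE).
split=> [u /r0|t u t0 /(r1 t u t0)|t u t0 /(r3 t u t0)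
    |t u t0 /(r4 t u t0)] //=;
by rewrite /= ?eqxx ?(negPf t0) ?mulr0 ?v0 ?mulr1 ?q_F.
Qed.
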